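(* Let $\mathbb{K}$ be a field and let $\mathcal{M}=(\mathcal{C},M)$ be a marked category. Then for any natural numbers $k,l$ $$\dim(\Omega_{k+l}\mathcal{M})\le\dim(\Omega_k\mathcal{M})\cdot\dim(\Omega_l\mathcal{M}).$$
   Context: A marked category is a pair $\mathcal{M}=(\mathcal{C},M)$ where $\mathcal{C}$ is a small category and $M$ is a set of morphisms of $\mathcal{C}$ containing all identity morphisms. The complex $\mathsf{N}\mathcal{C}$ is the normalized chain complex over $\mathbb{K}$ of the nerve of $\mathcal{C}$: $(\mathsf{N}\mathcal{C})_0$ has basis the objects of $\mathcal{C}$; for $n\ge1$, $(\mathsf{N}\mathcal{C})_n$ has basis the symbols $\langle\gamma_1,\dots,\gamma_n\rangle$, where $\gamma_1,\dots,\gamma_n$ are composable non-identity morphisms ($\mathrm{codom}(\gamma_i)=\mathrm{dom}(\gamma_{i+1})$); a symbol with some $\gamma_i$ an identity is $0$. The differential is $\partial=\sum_{i=0}^n(-1)^i\tilde d_i$ with $\tilde d_0\langle\gamma_1,\dots,\gamma_n\rangle=\langle\gamma_2,\dots,\gamma_n\rangle$, $\tilde d_i\langle\gamma_1,\dots,\gamma_n\rangle=\langle\gamma_1,\dots,\gamma_{i+1}\gamma_i,\dots,\gamma_n\rangle$ for $1\le i\le n-1$, $\tilde d_n\langle\gamma_1,\dots,\gamma_n\rangle=\langle\gamma_1,\dots,\gamma_{n-1}\rangle$ for $n\ge2$, and $\tilde d_0\langle\gamma\rangle=\mathrm{codom}(\gamma)$, $\tilde d_1\langle\gamma\rangle=\mathrm{dom}(\gamma)$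 for $n=1$. $\mathsf{N}M\subseteq\mathsf{N}\mathcal{C}$ is the graded submodule with $(\mathsf{N}M)_0=(\mathsf{N}\mathcal{C})_0$ and $(\mathsf{N}M)_n$ spanned by the $\langle\gamma_1,\dots,\gamma_n\rangle$ with all $\gamma_i\in M$. The chain complex $\Omega\mathcal{M}$ is the subcomplex of $\mathsf{N}\mathcal{C}$ with $\Omega_n\mathcal{M}=(\mathsf{N}M)_n\cap\partial^{-1}((\mathsf{N}M)_{n-1})$. *)

(* Defs.v *)
From HB Require Import structures.
From mathcomp Require Import all_boot all_algebra.
From mathcomp Require Import boolp classical_sets functions cardinality.
From mathcomp Require Import finmap monalg.

Set Implicit Arguments.
Unset Strict Implicit.
Unset Printing Implicit Defensive.

Import GRing.Theory.
Local Open Scope classical_set_scope.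
Local Open Scope ring_scope.

(* [compm g f] is the composite "g after f".  It is a total function, but the
   axioms constrain it only when [cod f = dom g]; its other values are junk and
   are never used below. *)
Record category := Category {
  obj : Type;
  mor : Type;
  dom : mor -> obj;
  cod : mor -> obj;
  idm : obj -> mor;
  compm : mor -> mor -> mor;
  dom_idm : forall x, dom (idm x) = x;
  cod_idm : forall x, cod (idm x) = x;
  dom_comp : forall g f, cod f = dom g -> dom (compm g f) = dom f;
  cod_comp : forall g f, cod f = dom g -> cod (compm g f) = cod g;
  comp_idl : forall f, compm (idm (cod f)) f = f;
  comp_idr : forall f, compm f (idm (dom f)) = f;
  compA : forall h g f, cod f = dom g -> cod g = dom h ->
    compm h (compm g f) = compm (compm h g) f
}.

HB.instance Definition _ (C : category) := gen_eqMixin (obj C).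
HB.instance Definition _ (C : category) := gen_choiceMixin (obj C).
HB.instance Definition _ (C : category) := gen_eqMixin (mor C).
HB.instance Definition _ (C : category) := gen_choiceMixin (mor C).

Record marked_category := MarkedCategory {
  ucat :> category;
  marked : set (mor ucat);
  marked_idm : forall x, marked (idm x)
}.

Section Nerve.
Variable C : category.

Fixpoint composable (x : obj C) (gs : seq (mor C)) : bool :=
  if gs is f :: gs' then (dom f == x) && composable (cod f) gs' else true.

Definition is_idm (f : mor C) : bool := f == idm (dom f).

(* A symbol <g1, ..., gn> is encoded as the pair (x, [:: g1; ...; gn]) where x is
   its source, i.e. x = dom g1 if n >= 1; thus x is redundant for n >= 1, and
   for n = 0 the symbols (x, [::]) are the objects. *)
Definition nondegenerate (n : nat) (s : obj C * seq (mor C)) : bool :=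
  [&& size s.2 == n, composable s.1 s.2 & all (predC is_idm) s.2].

Definition simplex (n : nat) : Type := {s | nondegenerate n s}.

HB.instance Definition _ n := SubType.on (simplex n).
HB.instance Definition _ n := Choice.on (simplex n).

(* Composes the entries number i and i + 1, counted from 0. *)
Fixpoint compose_at (i : nat) (gs : seq (mor C)) : seq (mor C) :=
  match i, gs with
  | 0, f :: g :: gs' => compm g f :: gs'
  | j.+1, f :: gs' => f :: compose_at j gs'
  | _, _ => gs
  end.

Definition face (n i : nat) (s : obj C * seq (mor C)) : obj C * seq (mor C) :=
  if i == 0%N then (head s.1 [seq cod f | f <- s.2], behead s.2)
  else if i == n then (s.1, take n.-1 s.2)
  else (s.1, compose_at i.-1 s.2).

End Nerve.

Section LinearAlgebra.
Variables (K : fieldType) (V : lmodType K).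

Definition lin_span (A : set V) : set V :=
  [set v | exists2 s : seq (K * V),
     (forall p, p \in s -> A p.2) & v = \sum_(p <- s) p.1 *: p.2].

Definition lin_free (A : set V) : Prop :=
  forall (s : seq V) (c : V -> K), uniq s -> (forall v, v \in s -> A v) ->
    \sum_(v <- s) c v *: v = 0 -> forall v, v \in s -> c v = 0.

Definition lin_basis (W B : set V) : Prop := lin_free B /\ lin_span B = W.

Definition lin_subspace (W : set V) : Prop :=
  W 0 /\ forall (a : K) (u v : V), W u -> W v -> W (a *: u + v).

Lemma lin_subspaceD W u v : lin_subspace W -> W u -> W v -> W (u + v).
Proof. by move=> [_ h] Wu Wv; rewrite -(scale1r u); apply: h. Qed.

Lemma lin_subspaceZ W a u : lin_subspace W -> W u -> W (a *: u).
Proof. by move=> [h0 h] Wu; rewrite -[_ *: _]addr0; apply: h. Qed.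

Lemma lin_span_subspace A : lin_subspace (lin_span A).
Proof.
split=> [|a _ _ [s sA ->] [t tA ->]].
  by exists [::] => //; rewrite big_nil.
exists ([seq (a * p.1, p.2) | p <- s] ++ t) => [p|].
  by rewrite mem_cat => /orP[/mapP[q qs ->]|/tA //]; exact: (sA q).
rewrite big_cat big_map scaler_sumr; congr (_ + _).
by apply: eq_bigr => p _; rewrite scalerA.
Qed.

Lemma lin_span_min A W : lin_subspace W -> A `<=` W -> lin_span A `<=` W.
Proof.
move=> subW AW _ [s sA ->]; elim: s sA => [|p s IH] sA.
  by rewrite big_nil; case: subW.
rewrite big_cons; apply: lin_subspaceD => //.
  by apply: lin_subspaceZ => //; apply/AW/sA; rewrite mem_head.
by apply: IH => q qs; apply: sA; rewrite in_cons qs orbT.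
Qed.

Lemma sub_lin_span A : A `<=` lin_span A.
Proof.
move=> v Av; exists [:: (1, v)] => [p|]; first by rewrite inE => /eqP->.
by rewrite big_seq1 scale1r.
Qed.

Lemma lin_basis_exists W : lin_subspace W -> exists B, lin_basis W B.
Proof.
move=> subW.
have [F Fchn totF|B [[BW freeB] maxB]] :=
    @Zorn_bigcup V [set B | B `<=` W /\ lin_free B].
  split=> [v [X FX Xv]|s c us sF]; first exact: (Fchn X FX).1.
  have [->|s0] := eqVneq s [::]; first by [].
  suff [X FX sX] : exists2 X, F X & forall v, v \in s -> X v.
    exact: (Fchn X FX).2.
  elim: s {us} s0 sF => // w s IH _ sF.
  have [X FX Xw] := sF w (mem_head _ _).
  have [s0|s0] := eqVneq s [::].
    by exists X => // v; rewrite s0 inE => /eqP->.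
  have [|Y FY Ys] := IH s0.
    by move=> v vs; apply: sF; rewrite in_cons vs orbT.
  have [XY|YX] := totF X Y FX FY.
    by exists Y => // v; rewrite in_cons => /orP[/eqP->|/Ys //]; apply: XY.
  by exists X => // v; rewrite in_cons => /orP[/eqP->//|/Ys]; apply: YX.
exists B; split=> //; apply/seteqP; split; first exact: lin_span_min.
move=> w Ww; apply: contrapT => nBw.
have nw : ~ B w by move=> /sub_lin_span.
apply: (maxB (w |` B)).
  split; first by move=> v Bv; right.
  by move=> /(_ w (or_introl erefl)).
split=> [v [->//|/BW//]|s c us sB s0].
have [ws|ws] := boolP (w \in s); last first.
  apply: (freeB s c) => // v vs.
  by have [vw|//] := sB v vs; rewrite -vw vs in ws.
have remB v : v \in rem w s -> B v.
  rewrite mem_rem_uniq // inE => /andP[vw vs].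
  by have [/eqP|//] := sB v vs; rewrite (negPf vw).
move: s0; rewrite (perm_big _ (perm_to_rem ws)) big_cons /= => s0.
have cw : c w = 0.
  apply: contrapT => /eqP cw0; apply: nBw.
  have -> : w = - (c w)^-1 *: \sum_(v <- rem w s) c v *: v.
    by rewrite scaleNr -(addr0_eq s0) scalerN opprK scalerA mulVf ?scale1r.
  apply: lin_subspaceZ; first exact: lin_span_subspace.
  exists [seq (c v, v) | v <- rem w s]; last by rewrite big_map.
  by move=> _ /mapP[v vs ->]; apply: remB.
rewrite cw scale0r add0r in s0 => v vs.
have [->//|vw] := eqVneq v w.
apply: (freeB (rem w s) c) => //; first exact: rem_uniq.
by rewrite mem_rem_uniq // inE vw.
Qed.

End LinearAlgebra.

Section Omega.
Variables (K : fieldType) (M : marked_category).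

Definition chain (n : nat) : lmodType K := {malg K[simplex M n]}.

(* The symbol s as a chain, which is 0 if s contains an identity (the faces of a
   simplex are always composable and of the right length). *)
Definition bracket (n : nat) (s : obj M * seq (mor M)) : chain n :=
  if insub s is Some u then << (u : simplex M n) >> else 0.

Definition boundary_simplex (n : nat) (s : simplex M n.+1) : chain n :=
  \sum_(i < n.+2) (-1) ^+ i *: bracket n (face n.+1 i (val s)).

Definition boundary (n : nat) (x : chain n.+1) : chain n :=
  \sum_(s <- msupp x) x@_s *: boundary_simplex s.

Definition marked_chain (n : nat) : set (chain n) :=
  lin_span [set << s >> | s in
    [set s : simplex M n | forall f, f \in (val s).2 -> marked f]].
Arguments marked_chain n : clear implicits.

(* The complex is 0 in degree -1, so nothing is required of the boundary in
   degree 0. *)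
Definition Omega (n : nat) : set (chain n) :=
  match n return set (chain n) with
  | 0 => marked_chain 0
  | m.+1 => marked_chain m.+1 `&` @boundary m @^-1` marked_chain m
  end.
Arguments Omega n : clear implicits.

Lemma boundary_linear n : linear (@boundary n).
Proof.
pose d (S : {fset simplex M n.+1}) (x : chain n.+1) : chain n :=
  \sum_(s <- S) x@_s *: boundary_simplex s.
have dE x (S : {fset simplex M n.+1}) : (msupp x `<=` S)%fset ->
    boundary x = d S x.
  move=> /fsubsetP xS; rewrite /boundary /d.
  rewrite (big_fsetID _ (mem (msupp x)) S) /= [X in _ + X]big1_fset ?addr0.
    by apply: eq_fbigl => s; rewrite !inE /= andb_idl // => /xS.
  by move=> s; rewrite !inE /= => /andP[_ /mcoeff_outdom->]; rewrite scale0r.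
move=> a x y; pose S := (msupp x `|` msupp y `|` msupp (a *: x + y))%fset.
have Sx : (msupp x `<=` S)%fset by rewrite /S -fsetUA fsubsetUl.
have Sy : (msupp y `<=` S)%fset by rewrite /S fsetUAC fsubsetUr.
have Sz : (msupp (a *: x + y) `<=` S)%fset by rewrite /S fsubsetUr.
rewrite (dE _ _ Sx) (dE _ _ Sy) (dE _ _ Sz).
rewrite /d scaler_sumr -big_split /=; apply: eq_bigr => s _.
by rewrite mcoeffD mcoeffZ scalerDl scalerA.
Qed.

HB.instance Definition _ n :=
  GRing.isLinear.Build K (chain n.+1) (chain n) *:%R (@boundary n)
    (@boundary_linear n).

Lemma Omega_subspace n : lin_subspace (Omega n).
Proof.
case: n => [|n]; first exact: lin_span_subspace.
have [h0 h] : lin_subspace (marked_chain n.+1) by exact: lin_span_subspace.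
have [g0 g] : lin_subspace (marked_chain n) by exact: lin_span_subspace.
split=> [|a u v [hu gu] [hv gv]]; first by split; rewrite //= linear0.
split; first exact: h a u v hu hv.
rewrite /preimage /= linearP.
exact: g a _ _ gu gv.
Qed.

Lemma Omega_basis_exists n : exists B, lin_basis (Omega n) B.
Proof. exact/lin_basis_exists/Omega_subspace. Qed.

End Omega.

Arguments boundary {K M n}.
Arguments marked_chain K M n : clear implicits.
Arguments Omega K M n : clear implicits.

(* Main.v *)
(* Cutting a symbol <g_1, ..., g_(k+l)> after its first k entries turns a chain x
   of degree k + l into a family of chains of degree k (fix the last l entries)
   and into a family of chains of degree l (fix the first k entries).  If x lies
   in Omega, so do all these slices, since a face that creates an unmarked
   morphism inside the front (back) part leaves the back (front) part alone.
   Well-order the symbols and call lead of a chain its largest symbol.  If (t, u)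
   is the largest pair (back, front) of x in the lexicographic order, then t and
   u are leads of slices of x; so there are at most as many leads in
   Omega_(k+l) as pairs of leads in Omega_l and Omega_k.  Finally, a Gaussian
   elimination shows that the number of leads of a subspace, with respect to any
   well-ordered coordinates, is its dimension, also when it is infinite. *)
Require Import Defs.
From mathcomp Require Import all_boot all_algebra.
From mathcomp Require Import boolp classical_sets functions cardinality.
From mathcomp Require Import finmap monalg.
From mathcomp Require wochoice.

Set Implicit Arguments.
Unset Strict Implicit.
Unset Printing Implicit Defensive.

Import GRing.Theory.
Local Open Scope classical_set_scope.
Local Open Scope card_scope.
Local Open Scope ring_scope.

(** * Injections as a comparison of cardinalities *)

(* A relation instead of a function, so that U may be empty. *)
Definition injects T U (A : set T) (B : set U) : Prop :=
  exists r : T -> U -> Prop,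
    (forall a, A a -> exists2 b, B b & r a b) /\
    (forall a a' b, r a b -> r a' b -> a = a').

Lemma injects_sub T U (A A' : set T) (B B' : set U) :
  A `<=` A' -> B' `<=` B -> injects A' B' -> injects A B.
Proof.
move=> AA BB [r [rA rI]]; exists r; split=> // a /AA/rA[b /BB Bb rab].
by exists b.
Qed.

Lemma injects_trans T U V (A : set T) (B : set U) (C : set V) :
  injects A B -> injects B C -> injects A C.
Proof.
move=> [r [rA rI]] [s [sB sI]]; exists (fun a c => exists2 b, r a b & s b c).
split=> [a /rA[b /sB[c Cc sbc] rab]|a a' c [b rab sbc] [b' rab' sbc']].
  by exists c => //; exists b.
by rewrite -(sI _ _ _ sbc sbc') in rab'; apply: rI rab rab'.
Qed.

Lemma injects_setX T U T' U' (A : set T) (B : set U) (A' : set T')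
    (B' : set U') :
  injects A A' -> injects B B' -> injects (A `*` B) (A' `*` B').
Proof.
move=> [r [rA rI]] [s [sB sI]].
exists (fun p q => r p.1 q.1 /\ s p.2 q.2); split.
  move=> [a b] [/= /rA[a' Aa' raa'] /sB[b' Bb' sbb']].
  by exists (a', b').
move=> [a b] [a' b'] [c d] /= [ra sb] [ra' sb'].
by rewrite (rI _ _ _ ra ra') (sI _ _ _ sb sb').
Qed.

Lemma injects_swap T U T' U' (A : set T) (B : set U) (A' : set T')
    (B' : set U') :
  injects A A' -> injects B B' -> injects (A `*` B) (B' `*` A').
Proof.
move=> hA hB; apply: injects_trans (injects_setX hA hB) _.
exists (fun p q => p = (q.2, q.1)); split=> [[a b] [/= Aa Bb]|a a' b -> ->//].
by exists (b, a).
Qed.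

Lemma injects_card_le T U (A : set T) (B : set U) : injects A B -> A #<= B.
Proof.
move=> [r [rA rI]]; have [->|/set0P[a0 Aa0]] := eqVneq A set0.
  by rewrite card_ge0.
(* [b0] will be the value of the function outside [A]; a nonempty [A] provides it. *)
have [b0 _ _] := rA _ Aa0.
have [a|f fP] := @choice _ _ (fun a b => A a -> B b /\ r a b).
  have [/rA[b Bb rab]|nAa] := pselect (A a); last by exists b0.
  by exists b.
have fI : {in A &, injective f}.
  move=> a a' /set_mem/fP[_ ra] /set_mem/fP[_ ra'] faa'.
  by rewrite -faa' in ra'; apply: rI ra ra'.
rewrite -(card_le_eql (inj_card_eq fI)); apply: subset_card_le.
by move=> _ [a /fP[Bfa _] <-].
Qed.

(** * Well-orders and their lexicographic product *)

(** Antisymmetry and least elements suffice: reflexivity, totality and transitivity come from the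
    least elements of sets listing one, two and three elements. *)
Definition well_order I (R : I -> I -> Prop) : Prop :=
  (forall i j, R i j -> R j i -> i = j) /\
  forall A : set I, A !=set0 -> exists2 m, A m & forall a, A a -> R m a.

Lemma well_order_exists (I : eqType) : exists R : I -> I -> Prop, well_order R.
Proof.
have [R woR] := wochoice.well_ordering_principle I.
have woR' : wochoice.wo_chain R predT by move=> A _; exact: woR.
exists R; split=> [i j Rij Rji|A [a Aa]].
  by apply: (wochoice.wo_chain_antisymmetric woR') => //; apply/andP.
have [|m [[mA mP] _]] := woR [pred x | `[< A x >]].
  by exists a; apply/asboolP.
exists m; first by exact/asboolP.
by move=> b Ab; apply: mP; apply/asboolP.
Qed.

Section WellOrder.
Variables (I : eqType) (R : I -> I -> Prop).
Hypothesis woR : well_order R.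

Lemma well_order_refl i : R i i.
Proof.
have [|m mi mP] := woR.2 [set i]; first by exists i.
by have := mP i erefl; rewrite mi.
Qed.

Lemma well_order_total i j : R i j \/ R j i.
Proof.
have [|m [] -> mP] := woR.2 [set i; j]; first by exists i; left.
  by left; apply: mP; right.
by right; apply: mP; left.
Qed.

Lemma well_order_trans i j k : R i j -> R j k -> R i k.
Proof.
move=> Rij Rjk; have [|m] := woR.2 [set x | [\/ x = i, x = j | x = k]].
  by exists i; apply: Or31.
move=> [] -> mP; first by apply: mP; apply: Or33.
  have -> : i = j by apply: woR.1 => //; apply: mP; apply: Or31.
  exact: Rjk.
have <- : j = k by apply: woR.1 => //; apply: mP; apply: Or32.
exact: Rij.
Qed.

(** Least elements are built into a well-order, while greatest ones come from finiteness: by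
    induction on [r], compare its head with the maximum of the rest. *)
Lemma finite_max (P : I -> Prop) (r : seq I) :
  (forall i, P i -> i \in r) -> (exists i, P i) ->
  exists2 m, P m & forall i, P i -> R i m.
Proof.
elim: r P => [|a r IH] P Pr [i Pi]; first by have := Pr i Pi.
have [[j [Pj nja]]|none] := pselect (exists j, P j /\ j <> a); last first.
  have all_a j : P j -> j = a.
    by move=> Pj; apply: contrapT => ?; apply: none; exists j.
  exists i => // j Pj; rewrite (all_a _ Pj) (all_a _ Pi).
  exact: well_order_refl.
have [||m [Pm nma] mP] := IH (fun j => P j /\ j <> a).
- by move=> k [Pk nka]; have := Pr k Pk; rewrite inE => /orP[/eqP|].
- by exists j.
have [Pa|nPa] := pselect (P a); last first.
  by exists m => // k Pk; apply: mP; split=> // ka; rewrite ka in Pk.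
have [Ram|Rma] := well_order_total a m.
  exists m => // k Pk; have [->//|ka] := pselect (k = a).
  exact: mP.
exists a => // k Pk; have [->|ka] := pselect (k = a).
  exact: well_order_refl.
by apply: well_order_trans Rma; apply: mP.
Qed.

End WellOrder.

Definition lex I J (R : I -> I -> Prop) (S : J -> J -> Prop) (p q : I * J) :=
  (R p.1 q.1 /\ p.1 <> q.1) \/ (p.1 = q.1 /\ S p.2 q.2).

Lemma lex_well_order I J (R : I -> I -> Prop) (S : J -> J -> Prop) :
  well_order R -> well_order S -> well_order (lex R S).
Proof.
move=> woR woS; split=> [[i j] [i' j']|A [[i0 j0] A0]].
  rewrite /lex /= => -[[Rii nii]|[<- Sjj]] [[Rii' nii']|[eii Sjj']] //.
  - by case: nii; apply: woR.1.
  - by rewrite -eii in nii.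
  by rewrite (woS.1 _ _ Sjj Sjj').
have [|i [j Aij] iP] := woR.2 [set i | exists j, A (i, j)].
  by exists i0, j0.
have [|k Aik kP] := woS.2 [set j | A (i, j)]; first by exists j.
exists (i, k) => // -[i' j'] A'; rewrite /lex /=.
have [eii|nii] := pselect (i = i'); last first.
  by left; split=> //; apply: iP; exists j'.
by right; split=> //; apply: kP; rewrite /= eii.
Qed.

(** * Leads of a subspace and its dimension *)

Section Coordinates.
Variables (K : fieldType) (V : lmodType K) (W : set V).
Hypothesis subW : lin_subspace W.

(** All three properties are asked on [W] only. This covers the coefficients of chains as well as
    the coordinates in a basis of [W], whose values outside [W] are arbitrary. *)
Definition coordinates (I : eqType) (c : V -> I -> K) : Prop :=
  [/\ forall a u v i, W u -> W v -> c (a *: u + v) i = a * c u i + c v i,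
      forall v, W v -> exists r : seq I, forall i, c v i != 0 -> i \in r &
      forall v, W v -> (forall i, c v i = 0) -> v = 0].

Definition lead I (R : I -> I -> Prop) (c : V -> I -> K) (v : V) (i : I) :=
  c v i != 0 /\ forall j, c v j != 0 -> R j i.

Definition leads I (R : I -> I -> Prop) (c : V -> I -> K) : set I :=
  [set i | exists2 v, W v & lead R c v i].

Lemma coordinates0 (I : eqType) (c : V -> I -> K) i :
  coordinates c -> c 0 i = 0.
Proof.
move=> [clin _ _]; have := clin (- 1) 0 0 i subW.1 subW.1.
by rewrite scaler0 addr0 mulN1r addNr.
Qed.

Lemma lead_exists (I : eqType) (R : I -> I -> Prop) (c : V -> I -> K) v :
  well_order R -> coordinates c -> W v -> v <> 0 -> exists i, lead R c v i.
Proof.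
move=> woR [_ cfin cinj] Wv v0; have [r rP] := cfin v Wv.
have [|i ci iP] := finite_max woR rP; last by exists i.
apply: contrapT => /forallNP h; apply: v0; apply: cinj => // i.
by apply/eqP; apply/negPn; apply/negP; apply: h.
Qed.

(* Gaussian elimination: among the vectors with a given c-lead choose one whose
   d-lead is minimal; two of these with the same d-lead would have a
   combination with the same c-lead but a smaller d-lead. *)
Lemma leads_injects (I J : eqType) (R : I -> I -> Prop) (S : J -> J -> Prop)
    (c : V -> I -> K) (d : V -> J -> K) :
  well_order R -> well_order S -> coordinates c -> coordinates d ->
  injects (leads R c) (leads S d).
Proof.
move=> woR woS cc cd; have [clin _ _] := cc; have [dlin _ _] := cd.
pose both i j := exists v, [/\ W v, lead R c v i & lead S d v j].
exists (fun i j => both i j /\ forall j', both i j' -> S j j'); split.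
  move=> i [v Wv vi]; have v0 : v <> 0.
    by move=> v0; case: vi; rewrite v0 coordinates0 ?eqxx.
  have [j vj] := lead_exists woS cd Wv v0.
  have [|m mA mP] := woS.2 [set j | both i j]; first by exists j, v.
  by exists m => //; case: mA => w [Ww _ wm]; exists w.
move=> i i' j [[u [Wu ui uj]] iP] [[v [Wv vi' vj]] iP'].
(* With [i] below [i'], adding a multiple of [u] to [v] cannot disturb the c-lead [i'] of [v]. *)
wlog Rii : i i' u v Wu ui uj iP Wv vi' vj iP' / R i i'.
  move=> H; have [Rii|Rii] := well_order_total woR i i'.
    exact: (H i i' u v).
  by apply/esym; exact: (H i' i v u).
(* The factor cancels the d-coordinate at [j], the common d-lead of [u] and [v]. The d-lead of [w]
   thus falls strictly below [j], against the minimality of [j] for [i']. *)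
apply: contrapT => nii; pose w := - (d v j / d u j) *: u + v.
have Ww : W w by apply: subW.2.
have cu x : R i' x -> c u x = 0.
  move=> Rx; apply/eqP; apply/negPn; apply/negP => /ui.2 Rxi.
  by apply: nii; apply: woR.1 => //; apply: well_order_trans Rx Rxi.
have cw : lead R c w i'.
  split.
    rewrite /w clin // (cu i') ?mulr0 ?add0r; last exact: well_order_refl.
    exact: vi'.1.
  move=> x; rewrite /w clin //; have [->|ux _] := eqVneq (c u x) 0.
    by rewrite mulr0 add0r => /vi'.2.
  by apply: well_order_trans Rii => //; apply: ui.2.
have w0 : w <> 0 by move=> w0; case: cw; rewrite w0 coordinates0 ?eqxx.
have [j' wj'] := lead_exists woS cd Ww w0.
have Sjj' : S j j' by apply: iP'; exists w.
have Sj'j : S j' j.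
  move: wj'.1; rewrite /w dlin //.
  have [->|ux _] := eqVneq (d u j') 0; last exact: uj.2.
  by rewrite mulr0 add0r => /vj.2.
have ejj : j = j' by apply: woS.1.
move: wj'.1; rewrite -ejj /w dlin // mulNr divfK ?addNr ?eqxx //.
exact: uj.1.
Qed.

(** [lin_free] speaks of lists without repetition; a relation with repeated vectors reduces to it by
    collecting the coefficients of equal vectors. *)
Lemma lin_free_coefs (B : set V) (s : seq (K * V)) :
  lin_free B -> (forall p, p \in s -> B p.2) ->
  \sum_(p <- s) p.1 *: p.2 = 0 -> forall b, \sum_(p <- s | p.2 == b) p.1 = 0.
Proof.
move=> freeB sB s0 b; pose t := undup [seq p.2 | p <- s].
pose e v := \sum_(p <- s | p.2 == v) p.1.
have tP p : p \in s -> p.2 \in t by move=> ps; rewrite mem_undup map_f.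
have [bt|bt] := boolP (b \in t); last first.
  rewrite big_seq_cond big1 // => p /andP[/tP pt /eqP pb].
  by rewrite pb (negPf bt) in pt.
apply: (freeB t e) => //; first exact: undup_uniq.
  by move=> v; rewrite mem_undup => /mapP[p /sB Bp ->].
rewrite -[RHS]s0 /e; under eq_bigr do rewrite scaler_suml big_mkcond /=.
rewrite exchange_big /= big_seq [RHS]big_seq; apply: eq_bigr => p /tP pt.
rewrite (bigD1_seq p.2) ?undup_uniq //= eqxx big1 ?addr0 // => v vp.
by rewrite eq_sym (negPf vp).
Qed.

Lemma basis_coordinates (B : set V) : lin_basis W B ->
  exists c : V -> V -> K,
    [/\ coordinates c, forall v b, W v -> c v b != 0 -> B b &
        forall b b', B b -> c b b' = (b == b')%:R].
Proof.
move=> [freeB spanB].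
have BW v : W v -> exists2 s : seq (K * V),
    (forall p, p \in s -> B p.2) & v = \sum_(p <- s) p.1 *: p.2.
  by rewrite -spanB.
have [v|s sP] := @choice _ _ (fun v (s : seq (K * V)) => W v ->
    (forall p, p \in s -> B p.2) /\ v = \sum_(p <- s) p.1 *: p.2).
  have [/BW[s sB vs]|nWv] := pselect (W v); last by exists [::].
  by exists s.
pose c v b := \sum_(p <- s v | p.2 == b) p.1.
(* The difference of two expressions of [v] is a relation in [B], so the collected coefficients do
   not depend on the chosen list [s v]. *)
have cE t v b : W v -> (forall p, p \in t -> B p.2) ->
    v = \sum_(p <- t) p.1 *: p.2 -> c v b = \sum_(p <- t | p.2 == b) p.1.
  move=> /sP[sB vs] tB vt; apply/eqP; rewrite -subr_eq0; apply/eqP.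
  pose n (p : K * V) := (- p.1, p.2).
  have := @lin_free_coefs B (s v ++ [seq n p | p <- t]) freeB.
  rewrite !big_cat /= !big_map /= -vs => H.
  rewrite -[RHS](H _ _ b); last 2 first.
  - move=> p; rewrite mem_cat => /orP[/sB//|/mapP[q /tB Bq ->]].
    exact: Bq.
  - by under eq_bigr do rewrite scaleNr; rewrite sumrN -vt subrr.
  by rewrite big_cat /= big_map /= sumrN.
exists c; split.
- split=> [a u v i Wu Wv|v Wv|v Wv cv].
  + have [uB us] := sP _ Wu; have [vB vs] := sP _ Wv.
    rewrite (@cE ([seq (a * p.1, p.2) | p <- s u] ++ s v)).
    * by rewrite big_cat /= big_map /= -mulr_sumr.
    * exact: subW.2.
    * move=> p; rewrite mem_cat => /orP[/mapP[q /uB Bq ->]|/vB//].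
      exact: Bq.
    * rewrite big_cat big_map /= -vs [in LHS]us scaler_sumr; congr (_ + _).
      by apply: eq_bigr => p _; rewrite scalerA.
  + exists [seq p.2 | p <- s v] => b.
    apply: contraR => bs.
    rewrite /c big_seq_cond big1 ?eqxx // => p /andP[ps /eqP pb].
    by rewrite -pb map_f in bs.
  + have [vB vs] := sP _ Wv; pose t := undup [seq p.2 | p <- s v].
    rewrite vs; transitivity (\sum_(b <- t) c v b *: b); last first.
      by rewrite big1 // => b _; rewrite cv scale0r.
    rewrite /c; under [RHS]eq_bigr do rewrite scaler_suml big_mkcond /=.
    rewrite exchange_big /= big_seq [RHS]big_seq; apply: eq_bigr => p ps.
    have pt : p.2 \in t by rewrite mem_undup map_f.
    rewrite (bigD1_seq p.2) ?undup_uniq //= eqxx big1 ?addr0 // => b bp.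
    by rewrite eq_sym (negPf bp).
- move=> v b Wv; apply: contraNP => nBb; have [vB _] := sP _ Wv.
  rewrite /c big_seq_cond big1 // => p /andP[/vB Bp /eqP pb].
  by rewrite pb in Bp.
- move=> b b' Bb; rewrite (@cE [:: (1, b)]).
  + by rewrite big_mkcond big_seq1; case: eqP.
  + by rewrite -spanB; apply: sub_lin_span.
  + by move=> p; rewrite inE => /eqP->.
  + by rewrite big_seq1 scale1r.
Qed.

(** In the coordinates of [B] itself each [b] in [B] has a single nonzero coordinate and is its own
    lead; elimination carries these leads to those of [c]. *)
Lemma basis_injects_leads (B : set V) (I : eqType) (R : I -> I -> Prop)
    (c : V -> I -> K) :
  lin_basis W B -> well_order R -> coordinates c -> injects B (leads R c).
Proof.
move=> Bbasis woR cc; have [d [cd dB dE]] := basis_coordinates Bbasis.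
have [S woS] := well_order_exists V.
apply: injects_trans (leads_injects woS woR cd cc).
exists eq; split=> [b Bb|_ _ b -> ->//]; exists b => //; exists b.
  by rewrite -Bbasis.2; apply: sub_lin_span.
split=> [|j]; first by rewrite dE // eqxx oner_eq0.
rewrite dE //; have [<- _|_] := eqVneq b j; last by rewrite eqxx.
exact: well_order_refl.
Qed.

(** Elimination carries the leads of [c] to leads in the coordinates of [B], which are nonzero
    coordinates and hence elements of [B]. *)
Lemma leads_injects_basis (B : set V) (I : eqType) (R : I -> I -> Prop)
    (c : V -> I -> K) :
  lin_basis W B -> well_order R -> coordinates c -> injects (leads R c) B.
Proof.
move=> Bbasis woR cc; have [d [cd dB _]] := basis_coordinates Bbasis.
have [S woS] := well_order_exists V.
apply: injects_sub (leads_injects woR woS cc cd) => // b [v Wv [vb _]].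
exact: dB vb.
Qed.

End Coordinates.

(** * Cutting symbols and merging adjacent morphisms *)

Section Symbols.
Variable C : category.
Implicit Types (x : obj C) (a b gs : seq (mor C)) (s : obj C * seq (mor C)).

Definition target s : obj C := last s.1 [seq cod f | f <- s.2].

Lemma composable_cat x a b :
  composable x (a ++ b) = composable x a && composable (target (x, a)) b.
Proof. by elim: a x => //= f a IH x; rewrite IH andbA. Qed.

Lemma compose_at_catl i a b :
  (i.+1 < size a)%N -> compose_at i (a ++ b) = compose_at i a ++ b.
Proof. by elim: i a => [|i IH] [|f [|g a]] //= ia; rewrite -IH. Qed.

Lemma compose_at_catr i a b :
  compose_at (size a + i) (a ++ b) = a ++ compose_at i b.
Proof. by elim: a => //= f a ->. Qed.

Lemma size_compose_at i gs :
  (i.+1 < size gs)%N -> size (compose_at i gs) = (size gs).-1.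
Proof. by elim: i gs => [|i IH] [|f [|g gs]] //= igs; rewrite IH. Qed.

(** An entry absent from [gs] can only be the new composite, which sits at position [i]. Out of
    range, [compose_at] changes nothing and no such entry arises. *)
Lemma mem_compose_at i gs a g b :
  compose_at i gs = a ++ g :: b -> g \notin gs ->
  size a = i /\ (i.+1 < size gs)%N.
Proof.
elim: i gs a => [|i IH] [|f gs] a //=.
- by case: a.
- case: gs => [|f' gs]; case: a => [|h a] //=.
  + by move=> [-> _]; rewrite inE eqxx.
  + by move=> [_]; case: a.
  + by move=> [_ ->]; rewrite !inE mem_cat mem_head !orbT.
- by case: a.
- case: a => [[-> _]|h a [_ e]] /=; first by rewrite mem_head.
  by rewrite inE negb_or => /andP[_ /(IH _ _ e)[-> ?]].
Qed.

Lemma composable_compose_at i x gs :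
  composable x gs ->
  composable x (compose_at i gs) /\
  target (x, compose_at i gs) = target (x, gs).
Proof.
rewrite /target /=; elim: i x gs => [|i IH] x [|f gs] //=.
  case: gs => [|g gs] //= /and3P[/eqP <- /eqP e cgs].
  by rewrite dom_comp ?cod_comp ?eqxx.
by move=> /andP[-> /IH[-> ->]].
Qed.

Lemma all_compose_at (P : pred (mor C)) i gs a g b :
  compose_at i gs = a ++ g :: b -> size a = i ->
  all P gs -> P g -> all P (compose_at i gs).
Proof.
elim: i gs a => [|i IH] [|f gs] [|h a] //=.
  by case: gs => [|f' gs] //= [<- _] _ /and3P[_ _ ->] ->.
by move=> [_ e] [sa] /andP[-> /(IH _ _ e sa)].
Qed.

Definition front (k : nat) s : obj C * seq (mor C) := (s.1, take k s.2).
Definition back (k : nat) s : obj C * seq (mor C) :=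
  (target (front k s), drop k s.2).

Lemma front_nondegenerate k l s :
  Defs.nondegenerate (k + l)%N s -> Defs.nondegenerate k (front k s).
Proof.
case: s => x gs /and3P[/= /eqP sz].
rewrite -{1 2}(cat_take_drop k gs) composable_cat all_cat.
move=> /andP[cf _] /andP[af _]; apply/and3P; split=> //=.
by rewrite size_takel // sz leq_addr.
Qed.

Lemma back_nondegenerate k l s :
  Defs.nondegenerate (k + l)%N s -> Defs.nondegenerate l (back k s).
Proof.
case: s => x gs /and3P[/= /eqP sz].
rewrite -{1 2}(cat_take_drop k gs) composable_cat all_cat.
move=> /andP[_ cf] /andP[_ af]; apply/and3P; split=> //=.
by rewrite size_drop sz addKn.
Qed.

Lemma front_back_inj k s t :
  front k s = front k t -> back k s = back k t -> s = t.
Proof.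
case: s t => x gs [y hs] [-> et] [_ ed].
by rewrite -(cat_take_drop k gs) et ed cat_take_drop.
Qed.

Definition merges_to a g b x : pred (obj C * seq (mor C)) :=
  fun s => (s.1, compose_at (size a) s.2) == (x, a ++ g :: b).

(** Merging inside the front keeps its target and leaves the back alone, so both conditions together
    are one merge of the whole symbol, with [q.2] appended. The length test makes the merge fall
    within the first [k] entries. *)
Lemma merges_to_front k l s q a g b x :
  Defs.nondegenerate (k + l)%N s -> g \notin s.2 ->
  (back k s == q) && merges_to a g b x (front k s) =
  [&& k == (size (a ++ g :: b)).+1, q.1 == target (x, a ++ g :: b) &
      merges_to a g (b ++ q.2) x s].
Proof.
case: s q => y gs [z hs] /= /and3P[/= /eqP sz cgs _] ngs.
rewrite /back /front /merges_to /=.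
have sk : size (take k gs) = k by rewrite size_takel // sz leq_addr.
have ngk : g \notin take k gs by apply: contra ngs; apply: mem_take.
move: cgs; rewrite -{1}(cat_take_drop k gs) composable_cat => /andP[ck _].
have [_ tk] := composable_compose_at (size a) ck.
apply/andP/and3P => [[/eqP[tc dc] /eqP[<- e]]|[/eqP kE /eqP zE /eqP[yx e]]].
  have [_ ak] := mem_compose_at e ngk.
  split.
  - by rewrite -e size_compose_at // sk prednK // -sk; apply: leq_trans ak.
  - by rewrite -tc -tk e.
  - by rewrite -{1}(cat_take_drop k gs) compose_at_catl // e dc -catA.
have ak : ((size a).+1 < size (take k gs))%N.
  by rewrite sk kE size_cat /= addnS !ltnS leq_addr.
move: e; rewrite -{1}(cat_take_drop k gs) compose_at_catl //.
rewrite -[RHS]/(a ++ (g :: b) ++ hs).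
rewrite catA => /eqP; rewrite eqseq_cat; last first.
  by rewrite size_compose_at // sk kE.
by move=> /andP[/eqP e /eqP ->]; rewrite -tk e zE yx.
Qed.

(** Position [size a] in the back is position [k + size a] in the whole symbol; the prefix [q.2]
    supplies the shift. *)
Lemma merges_to_back k l s q a g b x :
  Defs.nondegenerate (k + l)%N s -> size q.2 = k ->
  (front k s == q) && merges_to a g b x (back k s) =
  (x == target q) && merges_to (q.2 ++ a) g b q.1 s.
Proof.
case: s q => y gs [z hs] /= /and3P[/= /eqP sz _ _] sc.
rewrite /back /front /merges_to /=.
have sk : size (take k gs) = k by rewrite size_takel // sz leq_addr.
have := compose_at_catr (size a) (take k gs) (drop k gs).
rewrite sk cat_take_drop size_cat sc => ->.
rewrite -catA !xpair_eqE eqseq_cat ?sk ?sc //.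
case: (y =P z) => [->|_] /=; last by rewrite andbF.
case: eqP => [->|_] /=; last by rewrite andbF.
by rewrite eq_sym.
Qed.

End Symbols.

(** * Coefficients of chains and membership in [Omega] *)

Lemma monalgU_scale (K : fieldType) (T : choiceType) (c : K) (t : T) :
  << c *g t >> = c *: << t >> :> {malg K[T]}.
Proof.
apply/malgP => u; rewrite mcoeffZ !mcoeffU.
by case: (t == u); rewrite ?mulr1n ?mulr0n ?mulr1 ?mulr0.
Qed.

Section Chains.
Variables (K : fieldType) (M : marked_category).
Implicit Types (n k l : nat) (a b gs : seq (mor M)) (r : obj M * seq (mor M)).

Definition sum_coefs n (P : pred (obj M * seq (mor M))) (x : chain K M n) : K :=
  \sum_(s <- msupp x | P (val s)) x@_s.

(** [mmap] supplies additivity and evaluation over any larger support. *)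
Lemma sum_coefsE n P (x : chain K M n) :
  sum_coefs P x = mmap idfun (fun s : simplex M n => (P (val s))%:R) x.
Proof.
rewrite /sum_coefs /mmap big_mkcond; apply: eq_bigr => s _ /=.
by case: (P _); rewrite ?mulr1 ?mulr0.
Qed.

Lemma sum_coefs_linear n P (u : K) (x y : chain K M n) :
  sum_coefs P (u *: x + y) = u * sum_coefs P x + sum_coefs P y.
Proof.
rewrite !sum_coefsE mmapD; congr (_ + _).
rewrite (mmapEw (msuppZ_le u x)) mmapE mulr_sumr.
by apply: eq_bigr => s _; rewrite /= mcoeffZ mulrA.
Qed.

Lemma sum_coefs_bracket n P r :
  sum_coefs P (bracket K n r) = (Defs.nondegenerate n r && P r)%:R.
Proof.
rewrite /bracket; case: insubP => [u -> <-|/negPf ->] /=.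
  by rewrite sum_coefsE mmapU mul1r.
by rewrite sum_coefsE mmap0.
Qed.

Lemma mcoeff_bracket n r (u : simplex M n) :
  (bracket K n r)@_u = (r == val u)%:R.
Proof.
rewrite /bracket; case: insubP => [v _ <-|].
  by rewrite mcoeffU -(inj_eq val_inj).
by rewrite mcoeff0; case: eqP => // -> /negP[]; apply: valP.
Qed.

Lemma mcoeff_sum_coefs n (x : chain K M n) u :
  x@_u = sum_coefs (pred1 (val u)) x.
Proof.
rewrite /sum_coefs; under eq_bigl do rewrite /= (inj_eq val_inj).
rewrite big_mkcond; have [xu|xu] := boolP (u \in msupp x).
  rewrite (big_fsetD1 u) //= eqxx big1_fset ?addr0 // => s.
  by rewrite !inE => /andP[/negPf ->].
rewrite mcoeff_outdom // big1_fset // => s sx _; case: eqP => // su.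
by rewrite su in sx; rewrite sx in xu.
Qed.

Lemma marked_chainP n (x : chain K M n) :
  marked_chain K M n x <->
  forall s f, x@_s != 0 -> f \in (val s).2 -> marked f.
Proof.
split=> [[t tM ->] s f|xM].
  rewrite raddf_sum /= => t0 fs; apply: contrapT => nf; case/negP: t0.
  rewrite big_seq big1 // => p /tM [v vM <-]; rewrite mcoeffZ mcoeffU.
  by case: eqP => [vs|]; rewrite ?mulr0 //; case: nf; apply: vM; rewrite vs.
rewrite [x]monalgE; exists [seq (x@_s, << s >>) | s <- msupp x].
  move=> _ /mapP[s xs ->] /=; exists s => // f.
  by apply: xM; rewrite mcoeff_neq0.
rewrite big_map; apply: eq_bigr => s _ /=.
exact: monalgU_scale.
Qed.


Lemma boundary_unmarked m (x : chain K M m.+1) (u : simplex M m) o a g b :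
  marked_chain K M m.+1 x -> val u = (o, a ++ g :: b) -> ~ marked g ->
  (boundary x)@_u = (-1) ^+ (size a).+1 * sum_coefs (merges_to a g b o) x.
Proof.
move=> /marked_chainP xM uE ng.
have am : (size a < m)%N.
  have := valP u; rewrite uE => /and3P[/eqP <- _ _].
  by rewrite size_cat /= addnS ltnS leq_addr.
rewrite raddf_sum /= /sum_coefs [X in _ * X]big_mkcond mulr_sumr.
rewrite big_seq [RHS]big_seq.
apply: eq_bigr => s sx; rewrite mcoeffZ.
have gs : g \notin (val s).2.
  by apply/negP => /xM; rewrite mcoeff_neq0 => /(_ sx).
(* Face [i] composes the entries [i - 1] and [i], counted from 0, so a composite at position
   [size a] belongs to face [(size a).+1]. All other faces contribute 0 at [u]. *)
rewrite raddf_sum /= (bigD1 (inord (size a).+1)) //= inordK; last first.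
  by rewrite !ltnS ltnW.
rewrite big1 ?addr0 => [|i ia]; rewrite mcoeffZ mcoeff_bracket.
  rewrite /face /= eqSS (ltn_eqF am) uE /merges_to /=.
  by case: eqP => _; rewrite ?mulr1 ?mulr0 // mulrC.
(* The two outer faces only drop entries and cannot produce [g]. *)
rewrite uE /face; case: (i =P 0%N :> nat) => [_|/eqP i0].
  case: eqP => [[_ e]|_]; last by rewrite mulr0.
  case/negP: gs; apply: mem_behead.
  by rewrite e mem_cat mem_head orbT.
case: (i =P m.+1 :> nat) => [_|im].
  case: eqP => [[_ e]|_]; last by rewrite mulr0.
  by case/negP: gs; apply: (@mem_take m); rewrite e mem_cat mem_head orbT.
case: eqP => [[_ e]|_]; last by rewrite mulr0.
have [ai _] := mem_compose_at e gs; case/eqP: ia; apply: val_inj.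
rewrite /= ai inordK prednK ?lt0n //.
Qed.

(** A composite equal to an identity would be marked, so a merge that creates an unmarked [g] stays
    nondegenerate. *)
Lemma nondegenerate_merge m (s : simplex M m.+1) o a g b :
  merges_to a g b o (val s) -> g \notin (val s).2 -> ~ marked g ->
  Defs.nondegenerate m (o, a ++ g :: b).
Proof.
case: s => -[x gs] /= /and3P[/= /eqP sz cgs ags] /eqP[<- e] gN ng.
have [_ ags1] := mem_compose_at e gN.
have [cc _] := composable_compose_at (size a) cgs.
apply/and3P; split; rewrite /= -e //.
  by rewrite size_compose_at // sz.
apply: (all_compose_at e) => //=; apply/negP => /eqP gid; apply: ng.
by rewrite gid; apply: marked_idm.
Qed.

(* Merging two marked morphisms creates at most one unmarked one, which then
   records where the merge took place; so each unmarked symbol occurs in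
   the boundary of a marked chain through a single face operator, and signs are
   irrelevant. *)
Lemma OmegaP n (x : chain K M n) :
  Omega K M n x <->
  marked_chain K M n x /\
  forall o a g b, ~ marked g -> sum_coefs (merges_to a g b o) x = 0.
Proof.
case: n x => [|m] x /=.
  split=> [xM|[]//]; split=> // o a g b _.
  rewrite /sum_coefs big1_fset // => s _.
  have /and3P[/nilP e _ _] := valP s.
  by rewrite /merges_to /= e; case: (a) => [|? ?] /andP[_].
split=> [[xM dM]|[xM xC]]; split=> //.
  move=> o a g b ng.
  (* A nondegenerate symbol gives a coefficient of the boundary, which vanishes at unmarked symbols;
     for a degenerate one the sum is empty. *)
  have [gN|gN] := boolP (Defs.nondegenerate m (o, a ++ g :: b)).
    pose u : simplex M m := Sub (o, a ++ g :: b) gN.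
    have := @boundary_unmarked m x u o a g b xM erefl ng.
    have -> : (boundary x)@_u = 0.
      apply/eqP; apply/negPn; apply/negP => ux; apply: ng.
      move/marked_chainP: dM => /(_ _ _ ux); apply => /=.
      by rewrite mem_cat mem_head orbT.
    move=> /esym/eqP; rewrite mulf_eq0 signr_eq0 => /eqP; exact.
  rewrite /sum_coefs big_seq_cond big1 // => s /andP[sx sm].
  case/negP: gN; apply: (nondegenerate_merge sm _ ng); apply/negP => gs.
  apply: ng; apply: ((marked_chainP x).1 xM s) gs.
  by rewrite mcoeff_neq0.
apply/marked_chainP => u f uf fu; apply: contrapT => nf.
move: fu; case uE: (val u) => [o gs] /= fu.
case/splitPr: fu uE => a b uE; case/negP: uf.
by rewrite (boundary_unmarked xM uE nf) xC ?mulr0.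
Qed.

End Chains.

(** * Front and back slices of a chain *)

Section Slices.
Variables (K : fieldType) (M : marked_category).
Implicit Types (k l m n : nat) (P Q : pred (obj M * seq (mor M))).

Lemma eq_sum_coefs n P Q (x : chain K M n) :
  (forall s, x@_s != 0 -> P (val s) = Q (val s)) ->
  sum_coefs P x = sum_coefs Q x.
Proof.
move=> PQ; rewrite /sum_coefs big_seq_cond [RHS]big_seq_cond.
by apply: eq_bigl => s; case: msuppP => //= s0; apply: PQ; rewrite mcoeff_neq0.
Qed.

Lemma sum_coefs_neq0 n P (x : chain K M n) :
  sum_coefs P x != 0 -> exists2 s, x@_s != 0 & P (val s).
Proof.
move=> P0; apply: contrapT => none; case/eqP: P0.
rewrite (@eq_sum_coefs _ _ pred0) /sum_coefs ?big_pred0 // => s xs.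
by apply: negbTE; apply/negP => Ps; apply: none; exists s.
Qed.

(** Restriction to the symbols satisfying [P], followed by the linear extension of [h]; both kinds
    of slices are instances. *)
Definition push n m (P : pred (obj M * seq (mor M)))
    (h : obj M * seq (mor M) -> obj M * seq (mor M)) (x : chain K M n) :
    chain K M m :=
  \sum_(s <- msupp x | P (val s)) x@_s *: bracket K m (h (val s)).

Lemma sum_coefs_push n m P h Q (x : chain K M n) :
  (forall s : simplex M n, Defs.nondegenerate m (h (val s))) ->
  sum_coefs Q (push m P h x) = sum_coefs (fun s => P s && Q (h s)) x.
Proof.
move=> hm; rewrite /push [RHS]/sum_coefs big_mkcondr /=.
apply: (big_rec2 (fun y c => sum_coefs Q y = c)).
  by rewrite sum_coefsE mmap0.
move=> s c y _ IH; rewrite sum_coefs_linear IH sum_coefs_bracket hm /=.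
by case: (Q _); rewrite ?mulr1 ?mulr0.
Qed.

Variables (k l : nat).
Implicit Type x : chain K M (k + l)%N.

Lemma front_simplex (s : simplex M (k + l)%N) :
  Defs.nondegenerate k (front k (val s)).
Proof. exact: front_nondegenerate (valP s). Qed.

Lemma back_simplex (s : simplex M (k + l)%N) :
  Defs.nondegenerate l (back k (val s)).
Proof. exact: back_nondegenerate (valP s). Qed.

Definition front_slice (t : simplex M l) x : chain K M k :=
  push k (fun s => back k s == val t) (front k) x.

Definition back_slice (u : simplex M k) x : chain K M l :=
  push l (fun s => front k s == val u) (back k) x.

(** By [merges_to_front], each sum that must vanish for the slice is either empty or one that
    vanishes for [x], with the entries of [t] appended to [b]. *)
Lemma front_slice_Omega t x :
  Omega K M (k + l)%N x -> Omega K M k (front_slice t x).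
Proof.
move=> /OmegaP[/marked_chainP xM xC]; apply/OmegaP; split.
  apply/marked_chainP => s f.
  rewrite mcoeff_sum_coefs sum_coefs_push; last first.
    exact: front_simplex.
  move=> /sum_coefs_neq0[u xu /andP[_ /eqP <-]] /mem_take.
  exact: xM.
move=> o a g b ng; rewrite sum_coefs_push; last exact: front_simplex.
pose Q := [&& k == (size (a ++ g :: b)).+1 &
  (val t).1 == target (o, a ++ g :: b)].
rewrite (@eq_sum_coefs _ _ (fun s => Q && merges_to a g (b ++ (val t).2) o s)).
  case: Q; last by rewrite /sum_coefs big_pred0.
  exact: (xC o a g (b ++ (val t).2) ng).
move=> s xs; rewrite (@merges_to_front _ k l) ?andbA //; first exact: valP.
by apply/negP => /(xM _ _ xs).
Qed.

Lemma back_slice_Omega u x :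
  Omega K M (k + l)%N x -> Omega K M l (back_slice u x).
Proof.
move=> /OmegaP[/marked_chainP xM xC]; apply/OmegaP; split.
  apply/marked_chainP => s f.
  rewrite mcoeff_sum_coefs sum_coefs_push; last first.
    exact: back_simplex.
  move=> /sum_coefs_neq0[t xt /andP[_ /eqP <-]] /mem_drop.
  exact: xM.
move=> o a g b ng; rewrite sum_coefs_push; last exact: back_simplex.
pose Q := o == target (val u).
rewrite (@eq_sum_coefs _ _
  (fun s => Q && merges_to ((val u).2 ++ a) g b (val u).1 s)).
  case: Q; last by rewrite /sum_coefs big_pred0.
  exact: (xC (val u).1 ((val u).2 ++ a) g b ng).
move=> s xs; rewrite (@merges_to_back _ k l) //; first exact: valP.
by have /and3P[/eqP] := valP u.
Qed.

(** The coefficient of [x] at the symbol glued from the back [p.1] and the front [p.2], or 0 if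
    these do not fit together. *)
Definition split_coef x (p : simplex M l * simplex M k) : K :=
  sum_coefs (fun s => (back k s == val p.1) && (front k s == val p.2)) x.

Lemma mcoeff_front_slice t x u : (front_slice t x)@_u = split_coef x (t, u).
Proof.
by rewrite mcoeff_sum_coefs sum_coefs_push //; apply: front_simplex.
Qed.

Lemma mcoeff_back_slice u x t : (back_slice u x)@_t = split_coef x (t, u).
Proof.
rewrite mcoeff_sum_coefs sum_coefs_push; last exact: back_simplex.
by apply: eq_sum_coefs => s _; rewrite andbC.
Qed.

Lemma split_coef_coordinates : coordinates (Omega K M (k + l)%N) split_coef.
Proof.
pose bk (s : simplex M (k + l)%N) : simplex M l :=
  Sub (back k (val s)) (back_simplex s).
pose fr (s : simplex M (k + l)%N) : simplex M k :=
  Sub (front k (val s)) (front_simplex s).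
split=> [a u v p _ _|x _|x _ x0]; first exact: sum_coefs_linear.
  exists [seq (bk s, fr s) | s <- msupp x] => -[t u].
  move=> /sum_coefs_neq0[s xs /= /andP[/eqP bs /eqP fs]].
  apply/mapP; exists s; first by rewrite -mcoeff_neq0.
  by congr pair; apply: val_inj.
(* Front and back determine a symbol, so each coefficient of [x] is a split coefficient. *)
apply/malgP => s; rewrite mcoeff0 -(x0 (bk s, fr s)) mcoeff_sum_coefs.
apply: eq_sum_coefs => v _ /=.
apply/eqP/andP => [->|[/eqP bs /eqP fs]]; first by rewrite !eqxx.
exact: front_back_inj fs bs.
Qed.

End Slices.

(** * Leads in degree [k + l] and the dimension bound *)

Lemma mcoeff_coordinates (K : fieldType) (M : marked_category) n :
  coordinates (Omega K M n) (fun x s => x@_s).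
Proof.
split=> [a u v s _ _|x _|x _ x0]; first by rewrite mcoeffD mcoeffZ.
  by exists (msupp x) => s; rewrite mcoeff_neq0.
by apply/malgP => s; rewrite mcoeff0 x0.
Qed.

Lemma lead_split_coef (K : fieldType) (M : marked_category) (k l : nat)
    (R : simplex M k -> simplex M k -> Prop)
    (S : simplex M l -> simplex M l -> Prop) :
  well_order R -> well_order S ->
  leads (Omega K M (k + l)%N) (lex S R) (@split_coef K M k l) `<=`
  leads (Omega K M l) S (fun x s => x@_s) `*`
  leads (Omega K M k) R (fun x s => x@_s).
Proof.
move=> woR woS [t u] [x xO [xtu xmax]]; split=> /=.
  exists (back_slice u x); first exact: back_slice_Omega.
  split=> [|t']; rewrite mcoeff_back_slice // => /xmax[[//]|[/= -> _]].
  exact: well_order_refl.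
exists (front_slice t x); first exact: front_slice_Omega.
(* Both backs are [t], so the strict alternative of [lex] is absurd and the comparison of the fronts
   remains. *)
by split=> [|u']; rewrite mcoeff_front_slice // => /xmax[[_ /=]|[]].
Qed.

Theorem corollary10p6 (K : fieldType) (M : marked_category) (k l : nat)
    (Bkl : set (chain K M (k + l)%N))
    (Bk : set (chain K M k)) (Bl : set (chain K M l)) :
  lin_basis (Omega K M (k + l)%N) Bkl ->
  lin_basis (Omega K M k) Bk ->
  lin_basis (Omega K M l) Bl ->
  Bkl #<= Bk `*` Bl.
Proof.
move=> bkl bk bl; apply: injects_card_le.
have [R woR] := well_order_exists (simplex M k).
have [S woS] := well_order_exists (simplex M l).
have Lkl := basis_injects_leads (Omega_subspace _ _ _) bkl
  (lex_well_order woS woR) (@split_coef_coordinates K M k l).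
have Lk := leads_injects_basis (Omega_subspace _ _ _) bk woR
  (mcoeff_coordinates K M k).
have Ll := leads_injects_basis (Omega_subspace _ _ _) bl woS
  (mcoeff_coordinates K M l).
apply: injects_trans Lkl _.
(* Leads come as pairs (back, front), while the target is [Bk] times [Bl]; hence the swap. *)
exact: injects_sub (lead_split_coef woR woS) (@subset_refl _ _)
  (injects_swap Ll Lk).
Qed.
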